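(* Let $F:\mathbb{R}^n\times\mathbb{R}\times\mathbb{R}^n\to\mathbb{R}$ be a function and consider the partial differential equation $$F(x,u(x),Du(x))=0. \qquad (\ast)$$ Let $\mathcal{T}_j\subset\mathbb{R}^n$, $j=1,\ldots,m$, be closed sets and, for each $j$, let $u_j:\mathbb{R}^n\setminus\mathcal{T}_j\to\mathbb{R}$ be a function. Write $\mathcal{T}=\bigcup_{j=1}^m\mathcal{T}_j$. For $x\in\mathbb{R}^n\setminus\mathcal{T}$ define $$\bar u(x)=\min_{j\in\{1,\ldots,m\}}u_j(x),\qquad I(x)=\{j\in\{1,\ldots,m\} : u_j(x)=\min_{j'}u_{j'}(x)\},$$ and let $$\Sigma=\{x\in\mathbb{R}^n\setminus\mathcal{T} : \operatorname{card} I(x)>1\}.$$ (a) Suppose that, for each $j$, $u_j$ is a continuous viscosity supersolution of $(\ast)$ on $\mathbb{R}^n\setminus\mathcal{T}_j$. Then $\bar u$ is a continuous viscosity supersolution of $(\ast)$ on $\mathbb{R}^n\setminus\mathcal{T}$. (b) Suppose that, for each $j$, $u_j$ is a continuous viscosity subsolution of $(\ast)$ on $\mathbb{R}^n\setminus\mathcal{T}_j$, that $F$ is continuous, and that, for each $x\in\Sigma$ and each $j$, $u_j$ is Lipschitz continuous on a neighbourhood of $x$. Consider the following two hypotheses. (C): for every $x\in\Sigma$, every set of vectors $\{p_j : j\in I(x)\}$ with $p_j\in\partial^L u_j(x)$ for each $j\in I(x)$, and every collection of numbers $\lambda_j\ge 0$, $j\in I(x)$, with $\sum_{j\in I(x)}\lambda_j=1$,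 $$F\Big(x,\bar u(x),\sum_{j\in I(x)}\lambda_jp_j\Big)\le\sum_{j\in I(x)}\lambda_jF(x,u_j(x),p_j).$$ (E): for every $x\in\Sigma$, every set of vectors $\{p_j : j\in I(x)\}$ with $p_j\in\partial^L u_j(x)$ for each $j\in I(x)$, and every collection of numbers $\lambda_j\ge 0$, $j\in I(x)$, with $\sum_{j\in I(x)}\lambda_j=1$, $$F\Big(x,\bar u(x),\sum_{j\in I(x)}\lambda_jp_j\Big)\le 0.$$ Then: (i) if (E) holds, then $\bar u$ is a continuous viscosity subsolution of $(\ast)$ on $\mathbb{R}^n\setminus\mathcal{T}$; (ii) if, additionally, for each $x\in\Sigma$ and each $j$, $u_j$ is $C^1$ on a neighbourhood of $x$, and if $\bar u$ is a continuous viscosity subsolution of $(\ast)$ on $\mathbb{R}^n\setminus\mathcal{T}$, then (E) holds; (iii) (C) implies (E).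
   Context: For a continuous function $u$ defined on an open subset of $\mathbb{R}^n$ containing $x$, the Fréchet superdifferential and subdifferential are $$D^+u(x)=\Big\{p\in\mathbb{R}^n : \limsup_{y\to x}\frac{u(y)-u(x)-p\cdot(y-x)}{|x-y|}\le 0\Big\},$$ $$D^-u(x)=\Big\{p\in\mathbb{R}^n : \liminf_{y\to x}\frac{u(y)-u(x)-p\cdot(y-x)}{|x-y|}\ge 0\Big\}.$$ The limiting superdifferential is $$\partial^Lu(x)=\{p : \text{there exist sequences } p_i\to p,\ x_i\to x \text{ with } p_i\in D^+u(x_i)\text{ for each } i\}.$$ Let $\Omega\subset\mathbb{R}^n$ be open and $u:\Omega\to\mathbb{R}$. The function $u$ is a continuous viscosity subsolution of $F(x,u(x),Du(x))=0$ on $\Omega$ if it is continuous and $F(x,u(x),p)\le 0$ for all $x\in\Omega$ and $p\in D^+u(x)$. It is a continuous viscosity supersolution on $\Omega$ if it is continuous and $F(x,u(x),p)\ge 0$ for all $x\in\Omega$ and $p\in D^-u(x)$. *)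

(* Defs.v *)
From HB Require Import structures.
From mathcomp Require Import all_boot all_order all_algebra.
From mathcomp Require Import all_classical all_reals all_analysis.
Import Order.TTheory GRing.Theory Num.Theory.
Import numFieldNormedType.Exports.

Set Implicit Arguments.
Unset Strict Implicit.
Unset Printing Implicit Defensive.

Local Open Scope classical_set_scope.
Local Open Scope ring_scope.

(* A function on a subset Omega of R^n is a total function 'rV[R]_n -> R whose
   values outside Omega are irrelevant: Omega is open wherever these notions
   are used, and they only involve values on Omega or arbitrarily close to a
   point of Omega. *)

Section Differentials.
Context {R : realType} {n : nat}.
Implicit Types (u : 'rV[R]_n -> R) (x p v : 'rV[R]_n) (Omega V : set 'rV[R]_n).

Definition dotp p v : R := \sum_(i < n) p 0 i * v 0 i.

(* The norm of 'rV[R]_n in the library is the sup norm; the quotients below use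
   the Euclidean one. *)
Definition enorm v : R := Num.sqrt (dotp v v).

Definition diffquot u x p (y : 'rV[R]_n) : \bar R :=
  ((u y - u x - dotp p (y - x)) / enorm (x - y))%:E.

Definition superdiff u x : set 'rV[R]_n :=
  [set p | (limf_esup (diffquot u x p) x^' <= 0)%E].

Definition subdiff u x : set 'rV[R]_n :=
  [set p | (0 <= limf_einf (diffquot u x p) x^')%E].

Definition limiting_superdiff Omega u x : set 'rV[R]_n :=
  [set p | exists p_ x_ : nat -> 'rV[R]_n,
    [/\ p_ @ \oo --> p, x_ @ \oo --> x
      & forall i, Omega (x_ i) /\ superdiff u (x_ i) (p_ i)]].

Definition viscosity_subsolution (F : 'rV[R]_n * R * 'rV[R]_n -> R) Omega u :=
  {within Omega, continuous u} /\
  forall x p, Omega x -> superdiff u x p -> F (x, u x, p) <= 0.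

Definition viscosity_supersolution (F : 'rV[R]_n * R * 'rV[R]_n -> R) Omega u :=
  {within Omega, continuous u} /\
  forall x p, Omega x -> subdiff u x p -> 0 <= F (x, u x, p).

(* [lipschitz _ | _] refers to the sup norm; this only affects the constant. *)
Definition lipschitz_near Omega u x :=
  exists V, [/\ nbhs x V, V `<=` Omega & [lipschitz u y | y in V]].

Definition grad u x : 'rV[R]_n := \row_(i < n) 'D_(delta_mx 0 i) u x.

Definition C1_near Omega u x :=
  exists V, [/\ open_nbhs x V, V `<=` Omega,
    forall y, V y -> differentiable u y & {within V, continuous (grad u)}].

End Differentials.

(* The m >= 1 functions of the family are indexed by 'I_m'.+1 (m = m'.+1). *)
Section MinFamily.
Context {R : realType} {n m' : nat}.
Variables (F : 'rV[R]_n * R * 'rV[R]_n -> R)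
  (T : 'I_m'.+1 -> set 'rV[R]_n) (u : 'I_m'.+1 -> 'rV[R]_n -> R).

Definition union_sing : set 'rV[R]_n := \bigcup_j T j.

Definition ubar (x : 'rV[R]_n) : R := \big[Num.min/u ord0 x]_(j < m'.+1) u j x.

Definition active (x : 'rV[R]_n) : {set 'I_m'.+1} :=
  [set j | u j x == ubar x]%SET.

Definition Sigma : set 'rV[R]_n :=
  [set x | (~` union_sing) x /\ (1 < #|active x|)%N].

Definition convex_weights (x : 'rV[R]_n) (lam : 'I_m'.+1 -> R) :=
  (forall j, j \in active x -> 0 <= lam j) /\ \sum_(j in active x) lam j = 1.

Definition limiting_selection (x : 'rV[R]_n) (p : 'I_m'.+1 -> 'rV[R]_n) :=
  forall j, j \in active x -> limiting_superdiff (~` T j) (u j) x (p j).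

Definition condC := forall x p lam,
  Sigma x -> limiting_selection x p -> convex_weights x lam ->
  F (x, ubar x, \sum_(j in active x) lam j *: p j)
    <= \sum_(j in active x) lam j * F (x, u j x, p j).

Definition condE := forall x p lam,
  Sigma x -> limiting_selection x p -> convex_weights x lam ->
  F (x, ubar x, \sum_(j in active x) lam j *: p j) <= 0.

End MinFamily.

(* Main.v *)
Require Import Defs.
From HB Require Import structures.
From mathcomp Require Import all_boot all_order all_algebra.
From mathcomp Require Import all_classical all_reals all_analysis.
From mathcomp Require Import ring lra.
Import Order.TTheory GRing.Theory Num.Theory.
Import numFieldNormedType.Exports.

Set Implicit Arguments.
Unset Strict Implicit.

Local Open Scope classical_set_scope.
Local Open Scope ring_scope.

(** Why the theorem holds.

    A minimum of functions lies below each of them and meets the active ones,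
    so a subgradient of the minimum at [x] is a subgradient of every active
    [u j]: this gives (a).  In the same way, when [u j] is the only active
    function at [x], it coincides with the minimum near [x] and inherits its
    superdifferential.

    The substance of the proposition is (b)(i) at a point [x] of [Sigma].
    There one needs to know that each [p] in the superdifferential of the
    minimum is a convex combination of limiting supergradients of the active
    functions, with a single vector per function ([limiting_min_rule],
    specialised in [superdiff_ubar_hull]); hypothesis (E) then applies
    verbatim.  Subtracting the affine function of slope [p], assume that the
    value at [x] and [p] vanish; the functions become [w j] with
    [min_j w j y <= e |y - x|] near [x] for every [e > 0].  The variables are
    decoupled and the minimum is replaced by exponentials: one minimises

      [sum_j expR (- N * w j (y j)) + a * sum_j |y j - z|^2 + b * |z - x|^2]

    over a compact product of balls.  At a minimiser, optimality in [y j]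
    produces a supergradient [q j] of [w j] at [y j], namely
    [2 a / (N E_j) (y j - z)] with [E_j = expR (- N * w j (y j))]
    ([superdiff_exp_min]), while optimality in [z] balances the penalties,
    [a sum_j (y j - z) = b (z - x)] ([quadratic_min_critical]).  Hence, with
    the weights [E_j / sum_i E_i], the convex combination of the [q j] equals
    [2 b / (N sum_i E_i) (z - x)], which a suitable choice of [N], [a] and [b]
    makes as small as desired ([approximate_min_rule0]).  The Lipschitz bounds
    confine the [q j] to a ball, so compactness provides the exact limit.

    For (ii), a C^1 function has its gradient as only limiting supergradient,
    and a convex combination of the gradients of the active functions is a
    supergradient of the minimum.  For (iii), the subsolution inequality passes
    to limiting supergradients by continuity, which bounds the right-hand side
    of (C) by zero. *)

(** * The Euclidean pairing and the sup norm *)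

Section Pairing.
Context {R : realType} {n : nat}.
Implicit Types p q v w : 'rV[R]_n.

Lemma dotpC p v : dotp p v = dotp v p.
Proof. by apply: eq_bigr => i _; rewrite mulrC. Qed.

Lemma dotpDl p q v : dotp (p + q) v = dotp p v + dotp q v.
Proof. by rewrite -big_split; apply: eq_bigr => i _; rewrite mxE mulrDl. Qed.

Lemma dotpZl a p v : dotp (a *: p) v = a * dotp p v.
Proof. by rewrite mulr_sumr; apply: eq_bigr => i _; rewrite mxE mulrA. Qed.

Lemma dotpNl p v : dotp (- p) v = - dotp p v.
Proof. by rewrite -scaleN1r dotpZl mulN1r. Qed.

Lemma dotpDr p v w : dotp p (v + w) = dotp p v + dotp p w.
Proof. by rewrite !(dotpC p) dotpDl. Qed.

Lemma dotpZr a p v : dotp p (a *: v) = a * dotp p v.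
Proof. by rewrite !(dotpC p) dotpZl. Qed.

Lemma dotpNr p v : dotp p (- v) = - dotp p v.
Proof. by rewrite !(dotpC p) dotpNl. Qed.

Lemma dotp0r p : dotp p 0 = 0.
Proof. by rewrite -(scale0r 0) dotpZr mul0r. Qed.

Lemma dotp_suml (I : finType) (A : {set I}) (f : I -> 'rV[R]_n) v :
  dotp (\sum_(j in A) f j) v = \sum_(j in A) dotp (f j) v.
Proof.
apply: (big_morph (fun p => dotp p v)) => [p q|]; first exact: dotpDl.
by rewrite dotpC dotp0r.
Qed.

Lemma sqD v w : dotp (v + w) (v + w) = dotp v v + 2 * dotp v w + dotp w w.
Proof. by rewrite dotpDl !dotpDr (dotpC w v); ring. Qed.

Lemma coord_le_norm v i : `|v 0 i| <= `|v|.
Proof.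
rewrite -[`|v|]/(mx_norm v) mx_normrE.
exact: (@le_bigmax _ _ _ 0 (fun ij : 'I_1 * 'I_n => `|v ij.1 ij.2|) (0, i)).
Qed.

Lemma norm_le_coord v c : 0 <= c -> (forall i, `|v 0 i| <= c) -> `|v| <= c.
Proof.
move=> c0 vc; rewrite -[`|v|]/(mx_norm v) mx_normrE.
by apply: bigmax_le => //= -[i j] _ /=; rewrite ord1.
Qed.

Lemma dotp_le p v : `|dotp p v| <= n%:R * `|p| * `|v|.
Proof.
rewrite (le_trans (ler_norm_sum _ _ _))//.
have -> : n%:R * `|p| * `|v| = \sum_(i < n) `|p| * `|v|.
  by rewrite sumr_const card_ord -[RHS]mulr_natl mulrA.
by apply: ler_sum => i _; rewrite normrM ler_pM ?coord_le_norm.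
Qed.

Lemma sq_ge0 v : 0 <= dotp v v.
Proof. by apply: sumr_ge0 => i _; rewrite -expr2 sqr_ge0. Qed.

Lemma norm_sq_le v : `|v| ^+ 2 <= dotp v v.
Proof.
rewrite -ler_sqrt ?sq_ge0// sqrtr_sqr normr_id norm_le_coord ?sqrtr_ge0// => i.
rewrite -sqrtr_sqr ler_sqrt ?sq_ge0// /dotp (bigD1 i)//= -expr2 lerDl.
by apply: sumr_ge0 => k _; rewrite -expr2 sqr_ge0.
Qed.

Lemma sq_eq0 v : dotp v v <= 0 -> v = 0.
Proof.
move=> v0; apply/eqP; rewrite -normr_eq0 -sqrf_eq0 eq_le sqr_ge0 andbT.
exact: le_trans (norm_sq_le v) v0.
Qed.

Lemma norm_le_enorm v : `|v| <= enorm v.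
Proof.
by rewrite -[`|v|]normr_id -sqrtr_sqr ler_sqrt ?sq_ge0// norm_sq_le.
Qed.

Lemma enorm_le_norm v : enorm v <= n.+1%:R * `|v|.
Proof.
have nv0 : 0 <= n.+1%:R * `|v| by rewrite mulr_ge0.
rewrite -[leRHS]ger0_norm// -sqrtr_sqr ler_sqrt ?sqr_ge0//.
apply: le_trans (ler_norm _) _; apply: le_trans (dotp_le _ _) _.
rewrite exprMn -mulrA -expr2 ler_wpM2r ?sqr_ge0// -natrX ler_nat.
by rewrite (leq_trans (leqnSn n))// -mulnn leq_pmulr.
Qed.

End Pairing.

(** * Frechet superdifferentials *)

Section Frechet.
Context {R : realType} {n : nat}.
Implicit Types (u v : 'rV[R]_n -> R) (x p q : 'rV[R]_n).

(** The punctured limsup condition with its quotient cleared; since the norms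
    are equivalent, the sup norm may replace the Euclidean one. *)
Lemma superdiffP u x p : superdiff u x p <-> forall e, 0 < e ->
  \forall y \near x, u y - u x - dotp p (y - x) <= e * `|y - x|.
Proof.
have N0 : 0 < n.+1%:R :> R by [].
split=> [h e e0|h].
  have : (limf_esup (diffquot u x p) x^' < (e / n.+1%:R)%:E)%E.
    by apply: le_lt_trans h _; rewrite lte_fin divr_gt0.
  rewrite limf_esupE => /ereal_inf_lt[_ [V xV <-]] Ve.
  move: xV; rewrite /= /dnbhs /within /= => xV.
  apply: filterS xV => y yV.
  have [->|yx] := eqVneq y x; first by rewrite !subrr dotp0r normr0 mulr0 subrr.
  have en0 : 0 < enorm (x - y).
    by rewrite (lt_le_trans _ (norm_le_enorm _))// normr_gt0 subr_eq0 eq_sym.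
  have : (diffquot u x p y <= (e / n.+1%:R)%:E)%E.
    apply: le_trans (ltW Ve); apply: le_ereal_sup_tmp.
    exists (diffquot u x p y) => //; exists y => //.
    exact: yV.
  rewrite /diffquot lee_fin ler_pdivrMr// => /le_trans; apply.
  rewrite -mulrA ler_pM2l// ler_pdivrMl// distrC; exact: enorm_le_norm.
rewrite /superdiff/=; apply/lee_addgt0Pr => e e0; rewrite add0e limf_esupE.
pose V := [set y | y != x /\ u y - u x - dotp p (y - x) <= e * `|y - x|].
apply: ge_ereal_inf; exists (ereal_sup (diffquot u x p @` V)).
  exists V => //; rewrite /= /dnbhs /within /=.
  by apply: filterS (h _ e0) => y ye yx; split.
apply: ge_ereal_sup => _ [y [yx ye] <-]; rewrite /diffquot lee_fin.
have yx0 : 0 < `|x - y| by rewrite normr_gt0 subr_eq0 eq_sym.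
have en0 : 0 < enorm (x - y) by rewrite (lt_le_trans _ (norm_le_enorm _)).
rewrite ler_pdivrMr//; apply: le_trans ye _.
by rewrite ler_pM2l// distrC norm_le_enorm.
Qed.

Lemma subdiffE u x p : subdiff u x p <-> superdiff (fun y => - u y) x (- p).
Proof.
rewrite /subdiff /superdiff /= /limf_einf oppe_ge0.
suff -> : (\- diffquot u x p)%E = diffquot (fun y => - u y) x (- p) by [].
apply/funext => y; rewrite /diffquot -EFinN; congr EFin.
by rewrite -mulNr dotpNl; congr (_ / _); ring.
Qed.

(** Supergradients are slopes of upper bounds to first order, hence are
    inherited by a function touching from below. *)
Lemma superdiff_touch_below u v x p : v x = u x ->
  (\forall y \near x, v y <= u y) -> superdiff u x p -> superdiff v x p.
Proof.
move=> vux vu /superdiffP h; apply/superdiffP => e e0.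
apply: filterS2 (h _ e0) vu => y + vuy; rewrite vux.
by apply: le_trans; rewrite !lerD2r.
Qed.

Lemma superdiff_add_affine u x x0 p q (c : R) :
  superdiff (fun y => u y - (c + dotp p (y - x0))) x q ->
  superdiff u x (p + q).
Proof.
move=> /superdiffP h; apply/superdiffP => e e0.
apply: filterS (h _ e0) => y; apply: le_trans.
by rewrite dotpDl !(dotpDr p) !(dotpNr p); lra.
Qed.

Lemma superdiff_quadratic u x p (C : R) :
  (\forall y \near x, u y - u x - dotp p (y - x) <= C * `|y - x| ^+ 2) ->
  superdiff u x p.
Proof.
move=> h; apply/superdiffP => e e0.
have K0 : 0 < `|C| + 1 by rewrite ltr_wpDl.
have small : \forall y \near x, `|x - y| < e / (`|C| + 1).
  by apply/nbhs_normP; exists (e / (`|C| + 1)) => //=; rewrite divr_gt0.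
apply: filterS2 h small => y h; rewrite distrC ltr_pdivlMr// => yx.
apply: le_trans h _; rewrite expr2 mulrA ler_wpM2r//.
have := ler_norm C; have := normr_ge0 (y - x); nra.
Qed.

(** Testing the superdifferential inequality in the direction opposite to a
    coordinate of [p] shows that this coordinate cannot exceed the local
    rate of variation of [u]. *)
Lemma superdiff_bounded u x p (L : R) : 0 <= L ->
  (\forall y \near x, `|u y - u x| <= L * `|y - x|) ->
  superdiff u x p -> `|p| <= L.
Proof.
move=> L0 lip /superdiffP h; apply/ler_addgt0Pr => t t0; have {}h := h t t0.
have L1 : 0 <= L + t by lra.
apply: norm_le_coord => // i.
have key : \forall y \near x, - dotp p (y - x) <= (L + t) * `|y - x|.
  by apply: filterS2 lip h => y; rewrite ler_norml => /andP[? _] ?; lra.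
have [d /= d0 hd] := (nbhs_normP _ _).1 key.
(* the sign [s] selects the direction along which [u] is tested *)
have step s : `|s| = 1 -> - (s * p 0 i) <= L + t.
  move=> s1; pose e := delta_mx 0 i : 'rV[R]_n.
  have ne : `|e| <= 1.
    apply: norm_le_coord => // k; rewrite mxE.
    by case: eqP; case: eqP; rewrite ?normr1 ?normr0.
  have ep : dotp p e = p 0 i.
    rewrite /dotp (bigD1 i)//= big1 ?addr0 => [|k ki].
      by rewrite mxE !eqxx mulr1.
    by rewrite mxE (negPf ki) andbF mulr0.
  have := hd (x + (d / 2 * s) *: e).
  rewrite /ball_ /= opprD addNKr normrN addrC addKr normrZ dotpZr ep normrM.
  rewrite s1 mulr1.
  rewrite (gtr0_norm (x := d / 2)) ?divr_gt0// => /(_ _).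
  have d2 : d / 2 < d by lra.
  have := ler_pM2l (x := d / 2) _ `|e| 1.
  move=> /(_ ltac:(lra)); rewrite ne => ded.
  move=> /(_ ltac:(lra)) => H.
  have : d / 2 * (- (s * p 0 i)) <= d / 2 * (L + t) by nra.
  by rewrite ler_pM2l//; lra.
have := step 1 (normr1 _); have := step (-1) _; rewrite normrN1 => /(_ erefl).
by rewrite ler_norml; lra.
Qed.

End Frechet.

(** * Optimality conditions for the penalised problem *)

Section Penalty.
Context {R : realType} {n : nat}.

Lemma expR_le_quad (t : R) : `|t| <= 1 / 2 -> expR t <= 1 + t + 2 * t ^+ 2.
Proof.
rewrite ler_norml => /andP[t1 t2].
have := expR_ge1Dx (- t); rewrite expRN => h.
have E0 := expR_gt0 t.
have {}h : (1 - t) * expR t <= 1.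
  by rewrite -[leRHS](mulVf (lt0r_neq0 E0)) ler_pM2r.
have : (1 - t) * expR t <= (1 - t) * (1 + t + 2 * t ^+ 2) by nra.
by rewrite ler_pM2l//; lra.
Qed.

(** First-order optimality in one of the decoupled variables.  Minimality
    bounds the increment of [expR (- N * u)] from below by a smooth function;
    since [expR] is differentiable with positive derivative and [u] is
    Lipschitz, this turns into an upper bound on the increment of [u], up to a
    quadratic error. *)
Lemma superdiff_exp_min (u : 'rV[R]_n -> R) y0 z (N a L d : R) :
  0 < N -> 0 <= a -> 0 <= L -> 0 < d ->
  (forall y, `|y0 - y| < d -> `|u y - u y0| <= L * `|y - y0|) ->
  (forall y, `|y0 - y| < d ->
    expR (- (N * u y0)) + a * dotp (y0 - z) (y0 - z) <=
    expR (- (N * u y)) + a * dotp (y - z) (y - z)) ->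
  superdiff u y0 ((2 * a / (N * expR (- (N * u y0)))) *: (y0 - z)).
Proof.
move=> N0 a0 L0 d0 lip mini.
set E := expR (- (N * u y0)); have E0 : 0 < E by exact: expR_gt0.
(* beyond this radius [N * (u y - u y0)] may exceed 1/2 and the quadratic
   bound on the exponential is not available *)
have K0 : 0 < 2 * N * (L + 1) by rewrite !mulr_gt0//; lra.
apply: (superdiff_quadratic (C := a * n%:R / (N * E) + 2 * N * L ^+ 2)).
apply/nbhs_normP; exists (Num.min d (2 * N * (L + 1))^-1) => /=.
  by rewrite lt_min d0 invr_gt0.
move=> y /=; rewrite /ball_/= lt_min => /andP[yd].
rewrite -[ltRHS]div1r ltr_pdivlMr// distrC => yK.
have {mini} := mini _ yd; have {lip} := lip _ yd.
pose t := - N * (u y - u y0).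
have -> : - (N * u y) = - (N * u y0) + t by rewrite /t; ring.
rewrite expRD -/E => lip.
have -> : y - z = (y0 - z) + (y - y0) by rewrite [RHS]addrC addrA subrK.
rewrite (sqD (y0 - z) (y - y0)) => mini.
have tL : `|t| <= N * L * `|y - y0|.
  by rewrite /t normrM normrN (gtr0_norm N0) -mulrA ler_pM2l.
have := dotp_le (y - y0) (y - y0); rewrite ler_norml => /andP[_].
have h0 := normr_ge0 (y - y0).
move: lip mini; rewrite dotpZl; set h := `|y - y0| in yK tL h0 *.
set P := dotp (y0 - z) (y - y0); set Q := dotp (y - y0) _ => lip mini Qn.
have tq : t ^+ 2 <= (N * L * h) ^+ 2.
  by rewrite -(real_normK (num_real t)) lerXn2r// nnegrE ?mulr_ge0// ltW.
have th : `|t| <= 1 / 2 by nra.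
have Et := expR_le_quad th.
have key : E * (N * (u y - u y0)) <= a * (2 * P) + a * Q + E * (2 * t ^+ 2).
  have -> : N * (u y - u y0) = - t by rewrite /t; ring.
  have : E * expR t <= E * (1 + t + 2 * t ^+ 2) by rewrite ler_pM2l.
  by lra.
have NE0 : 0 < N * E by rewrite mulr_gt0.
rewrite -(ler_pM2l NE0).
have -> : N * E * (u y - u y0 - 2 * a / (N * E) * P) =
    E * (N * (u y - u y0)) - a * (2 * P).
  by field; rewrite ?gt_eqF.
have -> : N * E * ((a * n%:R / (N * E) + 2 * N * L ^+ 2) * h ^+ 2) =
    a * (n%:R * h * h) + E * (2 * (N * L * h) ^+ 2).
  by field; rewrite ?gt_eqF.
have : a * Q <= a * (n%:R * h * h) by rewrite ler_wpM2l.
have : E * (2 * t ^+ 2) <= E * (2 * (N * L * h) ^+ 2) by rewrite !ler_pM2l.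
lra.
Qed.

(** First-order optimality in the common variable.  If [v] is the difference
    of the two sides, moving [z] by [t *: v] changes the penalty by
    [- 2 t |v|^2 + O(t^2)], which is negative for small [t] unless [v = 0]. *)
Lemma quadratic_min_critical (I : finType) (A : {set I}) (y : I -> 'rV[R]_n)
    (x z : 'rV[R]_n) (a b d : R) : 0 <= a -> 0 <= b -> 0 < d ->
  (forall w, `|z - w| < d ->
    a * (\sum_(j in A) dotp (y j - z) (y j - z)) + b * dotp (z - x) (z - x) <=
    a * (\sum_(j in A) dotp (y j - w) (y j - w)) + b * dotp (w - x) (w - x)) ->
  a *: (\sum_(j in A) (y j - z)) = b *: (z - x).
Proof.
move=> a0 b0 d0 mini.
pose v := a *: (\sum_(j in A) (y j - z)) - b *: (z - x).
suff : v = 0 by move/eqP; rewrite subr_eq0 => /eqP.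
apply: sq_eq0; rewrite leNgt; apply/negP => v0.
pose C := a * #|A|%:R + b; have C0 : 0 <= C by rewrite addr_ge0// mulr_ge0.
pose t := Num.min (d / (2 * (`|v| + 1))) (1 / (C + 1)).
have vp : 0 < 2 * (`|v| + 1) by rewrite mulr_gt0// ltr_wpDl.
have t0 : 0 < t by rewrite lt_min !divr_gt0// ltr_wpDl.
have t1 : t * (2 * (`|v| + 1)) <= d by rewrite -ler_pdivlMr// ge_min lexx.
have t2 : t * (C + 1) <= 1 by rewrite -ler_pdivlMr ?ltr_wpDl// ge_min lexx orbT.
have zw : `|z - (z + t *: v)| < d.
  rewrite opprD addNKr normrN normrZ (gtr0_norm t0).
  by have := normr_ge0 v; nra.
have := mini (z + t *: v) zw.
have -> : z + t *: v - x = (z - x) + t *: v by rewrite addrAC.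
have -> : \sum_(j in A) dotp (y j - (z + t *: v)) (y j - (z + t *: v)) =
    \sum_(j in A) dotp (y j - z) (y j - z)
    - 2 * t * dotp (\sum_(j in A) (y j - z)) v + t ^+ 2 * #|A|%:R * dotp v v.
  rewrite dotp_suml mulr_sumr -sumrB.
  have -> : t ^+ 2 * #|A|%:R * dotp v v = \sum_(j in A) t ^+ 2 * dotp v v.
    by rewrite sumr_const -[RHS]mulr_natl; ring.
  rewrite -big_split; apply: eq_bigr => j _ /=.
  rewrite opprD addrA (sqD (y j - z)) !dotpNr !dotpNl !dotpZr !dotpZl; ring.
rewrite (sqD (z - x)) !dotpZr !dotpZl.
have vE : dotp v v = a * dotp (\sum_(j in A) (y j - z)) v - b * dotp (z - x) v.
  by rewrite {1}/v [LHS]dotpDl -scaleNr !dotpZl mulNr.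
move: vE v0 t2; rewrite /C.
set V := dotp v v; set P := dotp _ v; set Q := dotp (z - x) v.
move: (dotp (z - x) (z - x)) (\sum_(j in A) _) => X Y vE v0 t2 h.
have : 2 * t * V <= t * (t * C * V).
  by rewrite vE /C in h *; lra.
have -> : 2 * t * V = t * (2 * V) by ring.
rewrite ler_pM2l//; rewrite /C; nra.
Qed.

End Penalty.

Section Minimizer.
Import ArrowAsProduct.
Context {R : realType} {n : nat} (I : finType) (A : {set I}).
Variables (w : I -> 'rV[R]_n -> R) (x : 'rV[R]_n) (N a b : R).

(** The exponentials act as a smooth maximum of the [- w j], whose weights are
    positive for every [j]; each [w j] has its own variable, tied to [z] by the
    penalty [a], so that optimality can be read off function by function. *)
Definition penalized (y : I -> 'rV[R]_n) (z : 'rV[R]_n) : R :=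
  \sum_(j in A) expR (- (N * w j (y j)))
  + a * (\sum_(j in A) dotp (y j - z) (y j - z)) + b * dotp (z - x) (z - x).

Lemma cvg_sq (T : Type) (F : set_system T) {FF : Filter F}
    (f : T -> 'rV[R]_n) (l : 'rV[R]_n) :
  f t @[t --> F] --> l -> dotp (f t) (f t) @[t --> F] --> dotp l l.
Proof.
move=> fl; apply: cvg_big => [|i _]; first exact: add_continuous.
have fi : f t 0 i @[t --> F] --> l 0 i.
  exact: (cvg_comp f (fun v : 'rV[R]_n => v 0 i) fl
    (@coord_continuous _ _ _ 0 i l)).
exact: cvgM.
Qed.

(** [I -> 'rV[R]_n] carries the product topology, so that the domain is
    compact by Tychonoff's theorem. *)
Lemma penalized_attains_min (r : R) : 0 < r ->
  (forall j y, j \in A -> `|x - y| <= r -> {for y, continuous (w j)}) ->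
  exists y z, [/\ forall j, `|x - y j| <= r, `|x - z| <= r &
    forall y' z', (forall j, `|x - y' j| <= r) -> `|x - z'| <= r ->
      penalized y z <= penalized y' z'].
Proof.
move=> r0 wc; pose B := closed_ball_ (fun v : 'rV[R]_n => `|v|) x r.
have Bcpt : compact B.
  apply: bounded_closed_compact; last exact: closed_closed_ball_.
  exists (`|x| + r); split; first by rewrite num_real.
  move=> M Mr y /= By; rewrite -(subKr x y).
  by rewrite (le_trans (ler_normB _ _))// (le_trans _ (ltW Mr))// lerD2l.
pose K := [set y : I -> 'rV[R]_n | forall j, B (y j)] `*` B.
have Kcpt : compact K by apply: compact_setX => //; 
  exact: (@tychonoff I (fun=> 'rV[R]_n) (fun=> B)).
have Bx : B x by rewrite /B /closed_ball_/= subrr normr0 ltW.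
pose W (yz : (I -> 'rV[R]_n) * 'rV[R]_n) := penalized yz.1 yz.2.
have Wc : {within K, continuous W}.
  apply: continuous_in_subspaceT => -[y z] /set_mem[/= Ky Kz].
  have cj j : yz.1 j @[yz --> (y, z)] --> y j.
    apply: (@cvg_comp _ _ _ fst (proj j) _ (nbhs y)); first exact: cvg_fst.
    exact: proj_continuous.
  have cz : yz.2 @[yz --> (y, z)] --> z by exact: cvg_snd.
  apply: cvgD; first apply: cvgD.
  - apply: cvg_big => [|j jA]; first exact: add_continuous.
    have cw : w j (yz.1 j) @[yz --> (y, z)] --> w j (y j).
      exact: cvg_comp (cj j) (wc j (y j) jA (Ky j)).
    have cNw : - (N * w j (yz.1 j)) @[yz --> (y, z)] --> - (N * w j (y j)).
      by apply: cvgN; apply: cvgM => //; exact: cvg_cst.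
    exact: cvg_comp cNw (@continuous_expR R _).
  - apply: cvgM; first exact: cvg_cst.
    apply: cvg_big => [|j jA]; first exact: add_continuous.
    by apply: cvg_sq; apply: cvgB.
  - apply: cvgM; first exact: cvg_cst.
    by apply: cvg_sq; apply: cvgB => //; exact: cvg_cst.
have [|[y z] /set_mem[/= Ky Kz] mini] := compact_EVT_min _ Kcpt Wc.
  by exists ((fun=> x), x); split.
by exists y, z; split=> // y' z' Ky' Kz'; apply: (mini (y', z')); rewrite inE.
Qed.

End Minimizer.

(** * The rule for supergradients of a minimum *)

Section ApproximateMinRule.
Context {R : realType} {n : nat} (I : finType) (A : {set I}).

(** The parameters are scaled as follows, [k] being the number of functions.
    The value of the penalised functional at [x] is [k], so [b = k / r^2] and
    [a = k / s^2] force [|z - x| <= r] and [|y j - z| <= s].  With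
    [N = 1 / (r e)] and [L s <= e r], the function realising the near
    minimum at [z] satisfies [N * w j (y j) <= 2], so the exponentials sum to
    at least [c = expR (- 2)].  The convex combination of the supergradients
    then has norm at most [2 b r / (N c) = 2 k e / c], which is [eta] for the
    chosen [e]. *)
Lemma approximate_min_rule0 (w : I -> 'rV[R]_n -> R) x (rho L eta : R) :
  0 < rho -> 0 < L -> 0 < eta ->
  (forall j y y', j \in A -> `|x - y| < rho -> `|x - y'| < rho ->
    `|w j y - w j y'| <= L * `|y - y'|) ->
  (forall j, j \in A -> w j x = 0) ->
  (forall e, 0 < e ->
    \forall y \near x, exists2 j, j \in A & w j y <= e * `|y - x|) ->
  exists lam q y, [/\ forall j, j \in A -> 0 <= lam j,
    \sum_(j in A) lam j = 1,
    forall j, j \in A -> superdiff (w j) (y j) (q j),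
    forall j, j \in A -> `|x - y j| < eta
    & `|\sum_(j in A) lam j *: q j| <= eta].
Proof.
move=> rho0 L0 eta0 lip wx low.
have A0 : (0 < #|A|)%N.
  by have [j jA _] := nbhs_singleton (low _ ltr01); apply/card_gt0P; exists j.
pose k : R := #|A|%:R; have k0 : 0 < k by rewrite ltr0n.
pose c : R := expR (- 2); have c0 : 0 < c by exact: expR_gt0.
pose e := eta * c / (2 * k); have e0 : 0 < e by rewrite divr_gt0 ?mulr_gt0.
have [del /= del0 near_low] := (nbhs_normP _ _).1 (low e e0).
pose r := Num.min del (Num.min rho eta) / 8.
have r0 : 0 < r by rewrite divr_gt0// !lt_min del0 rho0.
have r_del : 8 * r <= del by rewrite mulrC mulfVK// ge_min lexx.
have r_rho : 8 * r <= rho by rewrite mulrC mulfVK// !ge_min lexx orbT.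
have r_eta : 8 * r <= eta by rewrite mulrC mulfVK// !ge_min lexx !orbT.
pose s := Num.min r (e * r / L).
have s0 : 0 < s by rewrite lt_min r0 divr_gt0// mulr_gt0.
have s_r : s <= r by rewrite ge_min lexx.
have s_L : L * s <= e * r by rewrite mulrC -ler_pdivlMr// ge_min lexx orbT.
pose a := k / s ^+ 2; have a0 : 0 < a by rewrite divr_gt0// exprn_gt0.
pose b := k / r ^+ 2; have b0 : 0 < b by rewrite divr_gt0// exprn_gt0.
have aE : a * s ^+ 2 = k by rewrite mulfVK// gt_eqF// exprn_gt0.
have bE : b * r ^+ 2 = k by rewrite mulfVK// gt_eqF// exprn_gt0.
pose N := (r * e)^-1; have N0 : 0 < N by rewrite invr_gt0 mulr_gt0.
have NE : N * (r * e) = 1 by rewrite mulVf// gt_eqF// mulr_gt0.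
have wc j y : j \in A -> `|x - y| <= rho / 2 -> {for y, continuous (w j)}.
  move=> jA xy; apply/(@cvgrPdist_lt _ _ _ (nbhs y)) => t t0.
  rewrite near_simpl; apply/nbhs_normP.
  exists (Num.min (rho / 2) (t / L)) => /=.
    by rewrite lt_min !divr_gt0.
  move=> y'; rewrite /ball_/= lt_min => /andP[yy' yt].
  have xy' : `|x - y'| < rho.
    by rewrite (le_lt_trans (ler_distD y _ _))//; lra.
  apply: le_lt_trans (lip _ _ _ jA _ xy') _; first by lra.
  by rewrite mulrC -ltr_pdivlMr.
have [y [z [yK zK mini]]] :=
  penalized_attains_min (A := A) N a b (divr_gt0 rho0 (ltr0n _ 2)) wc.
have Wk : penalized A w x N a b y z <= k.
  apply: le_trans (mini (fun=> x) x _ _) _ => [j||].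
  - by rewrite subrr normr0; lra.
  - by rewrite subrr normr0; lra.
  rewrite /penalized subrr dotp0r mulr0 addr0 [X in _ + _ * X]big1// mulr0 addr0.
  rewrite (eq_bigr (fun=> 1)) => [|j jA]; last by rewrite wx// mulr0 oppr0 expR0.
  by rewrite sumr_const.
have e_ge0 j : 0 <= expR (- (N * w j (y j))) by exact: expR_ge0.
have sume_ge0 : 0 <= \sum_(j in A) expR (- (N * w j (y j))).
  by apply: sumr_ge0.
have sumsq_ge0 : 0 <= \sum_(j in A) dotp (y j - z) (y j - z).
  by apply: sumr_ge0 => j _; exact: sq_ge0.
have zx_r : `|z - x| <= r.
  rewrite -(@ler_pXn2r _ 2) ?nnegrE ?(ltW r0)// -(ler_pM2l b0) bE.
  have zx := norm_sq_le (z - x); rewrite -(ler_pM2l b0) in zx.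
  by have := mulr_ge0 (ltW a0) sumsq_ge0; move: Wk; rewrite /penalized; lra.
have yz_s j : j \in A -> `|y j - z| <= s.
  move=> jA; rewrite -(@ler_pXn2r _ 2) ?nnegrE ?(ltW s0)// -(ler_pM2l a0) aE.
  have yz : `|y j - z| ^+ 2 <= \sum_(i in A) dotp (y i - z) (y i - z).
    rewrite (bigD1 j)//= (le_trans (norm_sq_le _))// lerDl sumr_ge0// => i _.
    exact: sq_ge0.
  rewrite -(ler_pM2l a0) in yz; have := mulr_ge0 (ltW b0) (sq_ge0 (z - x)).
  by move: Wk; rewrite /penalized; lra.
have xy_r j : j \in A -> `|x - y j| <= 2 * r.
  move=> jA; rewrite distrC (le_trans (ler_distD z _ _))//.
  by have := yz_s _ jA; lra.
have room j y' : j \in A -> `|y j - y'| < rho / 4 -> `|x - y'| <= rho / 2.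
  move=> jA yy'; rewrite (le_trans (ler_distD (y j) _ _))//.
  by have := xy_r _ jA; lra.
have y_super j : j \in A -> superdiff (w j) (y j)
    ((2 * a / (N * expR (- (N * w j (y j))))) *: (y j - z)).
  move=> jA; apply: (superdiff_exp_min (L := L) (d := rho / 4)) => //.
  - exact: ltW.
  - exact: ltW.
  - by rewrite divr_gt0.
  - move=> y' yy'; apply: lip => //.
      by have := room _ _ jA yy'; lra.
    by have := xy_r _ jA; lra.
  - move=> y' yy'.
    pose yy i := if i == j then y' else y i.
    have : penalized A w x N a b y z <= penalized A w x N a b yy z.
      apply: mini => // i; rewrite /yy; case: eqP => // _; exact: room yy'.
    have split_j v : penalized A w x N a b v z =
        (expR (- (N * w j (v j))) + a * dotp (v j - z) (v j - z)) +
        (\sum_(i in A | i != j) expR (- (N * w i (v i))) +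
         a * (\sum_(i in A | i != j) dotp (v i - z) (v i - z)) +
         b * dotp (z - x) (z - x)).
      by rewrite /penalized (bigD1 j jA) [X in a * X](bigD1 j jA) /=; ring.
    rewrite !split_j [X in _ <= _ + (X + _ + _)](eq_bigr
      (fun i => expR (- (N * w i (y i))))); last first.
      by move=> i /andP[_ /negPf ij]; rewrite /yy ij.
    rewrite [X in _ <= _ + (_ + a * X + _)](eq_bigr
      (fun i => dotp (y i - z) (y i - z))); last first.
      by move=> i /andP[_ /negPf ij]; rewrite /yy ij.
    by rewrite lerD2r /yy eqxx.
have crit : a *: (\sum_(j in A) (y j - z)) = b *: (z - x).
  have rho4 : 0 < rho / 4 by rewrite divr_gt0.
  apply: (quadratic_min_critical (ltW a0) (ltW b0) rho4) => z' zz'.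
  have : penalized A w x N a b y z <= penalized A w x N a b y z'.
    apply: mini => //; rewrite (le_trans (ler_distD z _ _))//.
    by move: zx_r; rewrite distrC; lra.
  by rewrite /penalized; lra.
pose S := \sum_(j in A) expR (- (N * w j (y j))).
have Sc : c <= S.
  have [|j jA wz] := near_low z.
    by rewrite /ball_/= distrC (le_lt_trans zx_r)//; lra.
  have : w j (y j) <= 2 * (r * e).
    have yj : `|x - y j| < rho by have := xy_r _ jA; lra.
    have xz : `|x - z| < rho by rewrite distrC; lra.
    have := le_trans (ler_norm _) (lip j (y j) z jA yj xz).
    have : L * `|y j - z| <= L * s by rewrite ler_pM2l// yz_s.
    have : e * `|z - x| <= e * r by rewrite ler_pM2l.
    by move: wz; lra.
  rewrite -(ler_pM2l N0) mulrCA NE => wy.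
  rewrite /S (bigD1 j)//= (@le_trans _ _ (expR (- (N * w j (y j)))))//.
    by rewrite ler_expR; lra.
  by rewrite lerDl sumr_ge0.
have S0 : 0 < S by exact: lt_le_trans Sc.
exists (fun j => expR (- (N * w j (y j))) / S).
exists (fun j => (2 * a / (N * expR (- (N * w j (y j))))) *: (y j - z)), y.
split=> //.
- by move=> j jA; rewrite divr_ge0// ltW.
- by rewrite -mulr_suml divff// gt_eqF.
- by move=> j jA; rewrite (le_lt_trans (xy_r _ jA))//; lra.
have -> : \sum_(j in A) (expR (- (N * w j (y j))) / S) *:
    ((2 * a / (N * expR (- (N * w j (y j))))) *: (y j - z)) =
    (2 / (N * S)) *: (b *: (z - x)).
  rewrite -crit scalerA scaler_sumr; apply: eq_bigr => j _.
  by rewrite scalerA; congr (_ *: _); field; rewrite !gt_eqF// expR_gt0.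
have NS0 : 0 < N * S by rewrite mulr_gt0.
rewrite scalerA normrZ gtr0_norm; last by rewrite mulr_gt0// divr_gt0.
have h1 : b * `|z - x| * r <= k.
  have -> : k = b * r * r by rewrite -mulrA -expr2 bE.
  by rewrite ler_pM2r// ler_pM2l.
have h2 : 2 * (k * e) <= eta * S.
  have -> : 2 * (k * e) = eta * c by rewrite /e; field; rewrite gt_eqF.
  by rewrite ler_pM2l.
have -> : 2 / (N * S) * b * `|z - x| = 2 * (b * `|z - x|) / (N * S) by ring.
rewrite ler_pdivrMr//.
rewrite -(ler_pM2r (mulr_gt0 r0 e0)).
have -> : eta * (N * S) * (r * e) = eta * S by rewrite -[RHS]mulr1 -NE; ring.
apply: le_trans h2.
by rewrite -(ler_pM2r e0) in h1; lra.
Qed.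

(** Reduction to the previous case by subtracting an affine function. *)
Lemma approximate_min_rule (u : I -> 'rV[R]_n -> R) x p (c rho L eta : R) :
  0 < rho -> 0 < L -> 0 < eta ->
  (forall j y y', j \in A -> `|x - y| < rho -> `|x - y'| < rho ->
    `|u j y - u j y'| <= L * `|y - y'|) ->
  (forall j, j \in A -> u j x = c) ->
  (forall e, 0 < e -> \forall y \near x,
    exists2 j, j \in A & u j y - c - dotp p (y - x) <= e * `|y - x|) ->
  exists lam q y, [/\ forall j, j \in A -> 0 <= lam j,
    \sum_(j in A) lam j = 1,
    forall j, j \in A -> superdiff (u j) (y j) (q j),
    forall j, j \in A -> `|x - y j| < eta
    & `|p - \sum_(j in A) lam j *: q j| <= eta].
Proof.
move=> rho0 L0 eta0 lip ux low.
pose w j y := u j y - (c + dotp p (y - x)).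
have L'0 : 0 < L + n%:R * `|p| by rewrite ltr_wpDr// mulr_ge0.
have [|j jA|e e0|lam [q [y [lam0 lam1 qy yx small]]]] :=
  approximate_min_rule0 (w := w) (x := x) rho0 L'0 eta0.
- move=> j y y' jA xy xy'; rewrite /w.
  have -> : u j y - (c + dotp p (y - x)) - (u j y' - (c + dotp p (y' - x))) =
      (u j y - u j y') - dotp p (y - y').
    by rewrite !dotpDr !dotpNr; ring.
  rewrite (le_trans (ler_normB _ _))// mulrDl lerD//; first exact: lip.
  exact: dotp_le.
- by rewrite /w ux// subrr dotp0r addr0 subrr.
- by apply: filterS (low _ e0) => y [j jA]; exists j; rewrite // /w opprD addrA.
exists lam, (fun j => p + q j), y; split=> //.
  by move=> j jA; apply: superdiff_add_affine; exact: qy.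
under eq_bigr do rewrite scalerDr.
by rewrite big_split/= -scaler_suml lam1 scale1r opprD addNKr normrN.
Qed.

End ApproximateMinRule.

Section Subsequences.
Import ArrowAsProduct.

(** One subsequence serves all members of a finite family, because the family
    is a single sequence in a compact product. *)
Lemma compact_family_subseq (R : realType) (I : finType)
    (V : pseudoMetricType R) (K : set V) (v : nat -> I -> V) :
  compact K -> (forall i j, K (v i j)) ->
  exists (k : nat -> nat) (w : I -> V), [/\ forall i, (i <= k i)%N,
    forall j, K (w j) & forall j, v (k i) j @[i --> \oo] --> w j].
Proof.
move=> Kcpt Kv.
have KIcpt := @tychonoff I (fun=> V) (fun=> K) (fun=> Kcpt).
have [|w [Kw clw]] := KIcpt (v @ \oo) _.
  by exists 0%N => // i _ j; exact: Kv.
have step i : exists k, (i <= k)%N /\ forall j, ball (w j) i.+1%:R^-1 (v k j).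
  have [||_ [[k ik <-] kw]] := clw [set v k | k in [set k | (i <= k)%N]]
      [set f | forall j, ball (w j) i.+1%:R^-1 (f j)] _ _.
  - by exists i => // k /= ik; exists k.
  - apply: (@filter_forall _ I (fun j f => ball (w j) i.+1%:R^-1 (f j))
      (nbhs w) (nbhs_filter w)) => j.
    have := @proj_continuous I (fun=> V) j w _ (nbhsx_ballx (w j) i.+1%:R^-1 _).
    by apply; rewrite invr_gt0.
  by exists k.
have [k hk] := choice step; exists k, w; split=> // [i|j]; first by case: (hk i).
apply/cvg_ballP => e e0; near=> i; apply: (@le_ball _ _ _ i.+1%:R^-1).
  by apply/ltW; near: i; exact: near_infty_natSinv_lt (PosNum e0).
by case: (hk i).
Unshelve. all: by end_near. Qed.

End Subsequences.

Section LimitingMinRule.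
Context {R : realType} {n : nat} (I : finType) (A : {set I}).

(** The approximate rule at scales tending to zero.  The supergradients it
    provides are bounded by the Lipschitz constant and the weights lie in
    [[0, 1]], so that all of them converge along a common subsequence. *)
Lemma limiting_min_rule (Om : I -> set 'rV[R]_n) (u : I -> 'rV[R]_n -> R) x p
    (c rho L : R) :
  0 < rho -> 0 < L ->
  (forall j y, j \in A -> `|x - y| < rho -> Om j y) ->
  (forall j y y', j \in A -> `|x - y| < rho -> `|x - y'| < rho ->
    `|u j y - u j y'| <= L * `|y - y'|) ->
  (forall j, j \in A -> u j x = c) ->
  (forall e, 0 < e -> \forall y \near x,
    exists2 j, j \in A & u j y - c - dotp p (y - x) <= e * `|y - x|) ->
  exists lam q, [/\ forall j, j \in A -> 0 <= lam j,
    \sum_(j in A) lam j = 1,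
    forall j, j \in A -> limiting_superdiff (Om j) (u j) x (q j)
    & \sum_(j in A) lam j *: q j = p].
Proof.
move=> rho0 L0 Omx lip ux low.
pose eta (i : nat) : R := Num.min rho i.+1%:R^-1.
have eta0 i : 0 < eta i by rewrite lt_min rho0 invr_gt0 ltr0n.
have eta_rho i : eta i <= rho by rewrite ge_min lexx.
have eta_inv i : eta i <= i.+1%:R^-1 by rewrite ge_min lexx orbT.
have /choice[lam /choice[q /choice[y approx]]] :=
  fun i => approximate_min_rule rho0 L0 (eta0 i) lip ux low.
pose B := closed_ball_ (fun v : 'rV[R]_n => `|v|) 0 L.
have Bcpt : compact B.
  apply: bounded_closed_compact; last exact: closed_closed_ball_.
  exists L; split; first by rewrite num_real.
  move=> M LM v; rewrite /B /closed_ball_/= sub0r normrN => /le_trans.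
  by apply; exact: ltW.
pose K : set ('rV[R]_n * R^o) := B `*` `[0, 1]%classic.
have Kcpt : compact K by apply: compact_setX => //; exact: segment_compact.
(* outside [A] the approximate rule gives no control, so default values keep
   the family in the compact set *)
pose v i j : 'rV[R]_n * R^o := if j \in A then (q i j, lam i j) else (0, 0).
have Kv i j : K (v i j).
  rewrite /v; case: ifP => jA; last first.
    rewrite /K /B /closed_ball_/= subrr normr0 in_itv/= lexx ler01.
    by split=> //; exact: ltW.
  have [lam0 lam1 qy yx _] := approx i; split=> /=.
    rewrite /B /closed_ball_/= sub0r normrN.
    apply: superdiff_bounded (qy _ jA); first exact: ltW.
    apply/nbhs_normP; exists (rho - `|x - y i j|) => /=.
      by rewrite subr_gt0 (lt_le_trans (yx _ jA)).
    move=> y'; rewrite /ball_/= => yy'; apply: lip => //.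
      by rewrite (le_lt_trans (ler_distD (y i j) _ _))//; lra.
    by rewrite (lt_le_trans (yx _ jA)).
  rewrite in_itv/= lam0//= -lam1 (bigD1 j)//= lerDl sumr_ge0// => l /andP[lA _].
  exact: lam0.
have [k [w [ik Kw vw]]] := compact_family_subseq Kcpt Kv.
have qw j : j \in A -> q (k i) j @[i --> \oo] --> (w j).1.
  move=> jA; have -> : (fun i => q (k i) j) = fst \o (fun i => v (k i) j).
    by apply/funext => i; rewrite /v /= jA.
  exact: cvg_comp (vw j) cvg_fst.
have lw j : j \in A -> lam (k i) j @[i --> \oo] --> ((w j).2 : R).
  move=> jA; have -> : (fun i => lam (k i) j) = snd \o (fun i => v (k i) j).
    by apply/funext => i; rewrite /v /= jA.
  exact: cvg_comp (vw j) cvg_snd.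
have inv_k i : (k i).+1%:R^-1 <= i.+1%:R^-1 :> R.
  by rewrite lef_pV2 ?posrE// ler_nat ltnS.
exists (fun j => (w j).2), (fun j => (w j).1); split.
- by move=> j _; have [_ /=] := Kw j; rewrite in_itv/= => /andP[].
- have : \sum_(j in A) lam (k i) j @[i --> \oo] --> \sum_(j in A) (w j).2.
    by apply: cvg_big => [|j jA]; [exact: add_continuous | exact: lw].
  have -> : (fun i => \sum_(j in A) lam (k i) j) = cst 1.
    by apply/funext => i; have [] := approx (k i).
  by move=> /(cvg_unique _ (cvg_cst _)) <-.
- move=> j jA; exists (fun i => q (k i) j), (fun i => y (k i) j); split.
  + exact: qw.
  + apply/cvgrPdist_lt => e e0; near=> i.
    have [_ _ _ yx _] := approx (k i); apply: lt_le_trans (yx _ jA) _.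
    rewrite (le_trans (eta_inv _))// (le_trans (inv_k _))//; apply/ltW.
    by near: i; exact: near_infty_natSinv_lt (PosNum e0).
  + move=> i; have [_ _ qy yx _] := approx (k i); split; last exact: qy.
    by apply: Omx => //; rewrite (lt_le_trans (yx _ jA)).
- have lim_sum : \sum_(j in A) lam (k i) j *: q (k i) j @[i --> \oo] -->
      \sum_(j in A) (w j).2 *: (w j).1.
    apply: cvg_big => [|j jA]; first exact: add_continuous.
    by apply: cvgZ; [exact: lw | exact: qw].
  suff lim_p : \sum_(j in A) lam (k i) j *: q (k i) j @[i --> \oo] --> p.
    exact: norm_cvg_unique lim_sum lim_p.
  apply/cvgrPdist_lt => e e0; near=> i.
  have [_ _ _ _ small] := approx (k i); apply: le_lt_trans small _.
  rewrite (le_lt_trans (eta_inv _))// (le_lt_trans (inv_k _))//.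
  by near: i; exact: near_infty_natSinv_lt (PosNum e0).
Unshelve. all: by end_near. Qed.

End LimitingMinRule.

(** * Differentiable functions *)

Section Differentiable.
Context {R : realType} {n : nat}.
Implicit Types (u : 'rV[R]_n -> R) (x p v : 'rV[R]_n).

Lemma diff_grad u x v : differentiable u x -> 'd u x v = dotp (grad u x) v.
Proof.
move=> du; rewrite [in LHS](row_sum_delta v) linear_sum; apply: eq_bigr => i _.
by rewrite linearZ /= mxE deriveE// mulrC.
Qed.

Lemma differentiable_expansion u x : differentiable u x -> forall e, 0 < e ->
  \forall y \near x, `|u y - u x - dotp (grad u x) (y - x)| <= e * `|y - x|.
Proof.
move=> du e e0; have [_ /eqaddoP/(_ e e0)] := (diff_locallyP _ _).1 du.
move=> /nbhs_normP[d /= d0 h]; apply/nbhs_normP; exists d => // y.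
rewrite /ball_/= => yd; have := h (y - x).
rewrite /ball_/= sub0r normrN distrC => /(_ yd).
rewrite -diff_grad// !fctE /= subrK opprD addrA; exact: id.
Qed.

(** [p - grad u x] is a supergradient of a constant, whose local rate of
    variation is zero. *)
Lemma superdiff_differentiable u x p :
  differentiable u x -> superdiff u x p -> p = grad u x.
Proof.
move=> du /superdiffP up; apply/eqP; rewrite -subr_eq0 -normr_le0.
apply: (superdiff_bounded (u := fun=> 0) (x := x)) => //.
  by apply/nbhs_normP; exists 1 => //= y _; rewrite subrr normr0 mul0r.
apply/superdiffP => e e0; have e2 : 0 < e / 2 by rewrite divr_gt0.
apply: filterS2 (up _ e2) (differentiable_expansion du e2) => y uy.
by rewrite ler_norml dotpDl dotpNl; lra.
Qed.

End Differentiable.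

(** * Passing to limiting supergradients *)

Section Subsolution.
Context {R : realType} {n : nat} (F : 'rV[R]_n * R * 'rV[R]_n -> R).

Lemma subsolution_limiting_superdiff Om u x p : continuous F -> open Om ->
  viscosity_subsolution F Om u -> Om x -> limiting_superdiff Om u x p ->
  F (x, u x, p) <= 0.
Proof.
move=> Fc Omo [uc usub] Omx [p_ [x_ [pp xx h]]].
have ucx : {for x, continuous u}.
  by move: uc; rewrite continuous_open_subspace//; apply; rewrite inE.
have Flim : F (x_ i, u (x_ i), p_ i) @[i --> \oo] --> F (x, u x, p).
  have : (x_ i, u (x_ i), p_ i) @[i --> \oo] --> (x, u x, p).
    exact: (cvg_pair (cvg_pair xx (cvg_comp _ _ xx ucx)) pp).
  by move=> lim3; exact: cvg_comp lim3 (Fc _).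
apply: (@closed_cvg _ _ \oo _ _ [set r : R | r <= 0] _ _ _ Flim).
  exact: closed_le.
by apply: nearW => i /=; have [? ?] := h i; exact: usub.
Qed.

End Subsolution.

(** * Pointwise minima of a finite family *)

Section MinFamily.
Context {R : realType} {n m' : nat}.
Variable u : 'I_m'.+1 -> 'rV[R]_n -> R.

Lemma ubar_le j x : ubar u x <= u j x.
Proof. by rewrite /ubar (bigD1 j)//= ge_min lexx. Qed.

Lemma ubar_attained x : exists j, ubar u x = u j x.
Proof.
rewrite /ubar; elim/big_ind: _ => [|a b [i ->] [j ->]|j _].
- by exists ord0.
- by rewrite /Num.min; case: ifP => _; [exists i | exists j].
- by exists j.
Qed.

Lemma activeP x j : reflect (u j x = ubar u x) (j \in active u x).
Proof. by rewrite inE; exact: eqP. Qed.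

Lemma ubar_continuous x :
  (forall j, {for x, continuous (u j)}) -> {for x, continuous (ubar u)}.
Proof.
move=> uc; rewrite /ubar.
elim: (index_enum _) => [|j s IH].
  by rewrite (_ : (fun y => _) = u ord0)//; apply/funext => y; rewrite big_nil.
rewrite (_ : (fun y => _) =
  u j \min (fun y => \big[Num.min/u ord0 y]_(j <- s) u j y)).
  exact: continuous_min.
by apply/funext => y; rewrite big_cons.
Qed.

(** A function that is not active at [x] exceeds the minimum there by a
    positive gap, which continuity preserves nearby. *)
Lemma near_active x : (forall j, {for x, continuous (u j)}) ->
  \forall y \near x, forall j, u j y = ubar u y -> j \in active u x.
Proof.
move=> uc.
apply: (@filter_forall _ _ (fun j y => u j y = ubar u y -> j \in active u x)
  (nbhs x) (nbhs_filter x)) => j.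
have [jA|jA] := boolP (j \in active u x); first exact: nearW.
have ltj : ubar u x < u j x.
  rewrite lt_neqAle ubar_le andbT.
  by apply: contra jA => /eqP e; apply/activeP; rewrite e.
have d0 : 0 < (u j x - ubar u x) / 2 by rewrite divr_gt0// subr_gt0.
have near_u : \forall y \near x, `|u j x - u j y| < (u j x - ubar u x) / 2.
  exact: (@cvgrPdist_lt _ _ _ (nbhs x) _ _ _).1 (uc j) _ d0.
have near_ubar : \forall y \near x,
    `|ubar u x - ubar u y| < (u j x - ubar u x) / 2.
  exact: (@cvgrPdist_lt _ _ _ (nbhs x) _ _ _).1 (ubar_continuous uc) _ d0.
apply: filterS2 near_u near_ubar => y; rewrite !ltr_norml => /andP[? ?] /andP[? ?] ?.
lra.
Qed.

End MinFamily.

(** * Minima of viscosity sub- and supersolutions *)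

Section ViscosityMin.
Context {R : realType} {n m' : nat}.
Variables (F : 'rV[R]_n * R * 'rV[R]_n -> R)
  (T : 'I_m'.+1 -> set 'rV[R]_n) (u : 'I_m'.+1 -> 'rV[R]_n -> R).
Hypothesis Tclosed : forall j, closed (T j).
Hypothesis ucont : forall j, {within ~` T j, continuous (u j)}.

Lemma off_singE x : (~` union_sing T) x <-> forall j, (~` T j) x.
Proof. by split=> [xT j Tx|xT [j _ Tx]]; [apply: xT; exists j | exact: xT Tx]. Qed.

Lemma family_continuous x j : (~` union_sing T) x -> {for x, continuous (u j)}.
Proof.
move=> /off_singE xT; move: (@ucont j); rewrite continuous_open_subspace.
  by apply; rewrite inE.
exact: closed_openC.
Qed.

Lemma ubar_continuous_off_sing : {within ~` union_sing T, continuous (ubar u)}.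
Proof.
apply: continuous_in_subspaceT => x /set_mem xT.
by apply: ubar_continuous => j; exact: family_continuous.
Qed.

(** Finitely many neighbourhoods and Lipschitz constants admit a common
    choice. *)
Lemma common_lipschitz_ball x :
  (forall j, lipschitz_near (~` T j) (u j) x) ->
  exists rho L, [/\ 0 < rho, 0 < L,
    forall j y, `|x - y| < rho -> (~` T j) y
    & forall j y y', `|x - y| < rho -> `|x - y'| < rho ->
      `|u j y - u j y'| <= L * `|y - y'|].
Proof.
move=> /choice[V lipV].
have [rho /= rho0 ball_V] : exists2 rho, 0 < rho &
    forall y, `|x - y| < rho -> forall j, V j y.
  have /nbhs_normP[rho /= rho0 hrho] : \forall y \near x, forall j, V j y.
    apply: (@filter_forall _ _ (fun j y => V j y) (nbhs x) (nbhs_filter x)) => j.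
    by case: (lipV j).
  by exists rho.
have [L [L0 lipL]] : exists L, 0 < L /\ forall j y y', V j y -> V j y' ->
    `|u j y - u j y'| <= L * `|y - y'|.
  have lip_near : \forall M \near +oo, forall j y y', V j y -> V j y' ->
      `|u j y - u j y'| <= M * `|y - y'|.
    apply: (@filter_forall _ _ (fun j M => forall y y', V j y -> V j y' ->
      `|u j y - u j y'| <= M * `|y - y'|) (pinfty_nbhs R) _) => j.
    have [_ _ [M0 [M0r lipM0]]] := lipV j; exists M0; split=> // M /lipM0 lipM.
    move=> y y' Vy Vy'.
    exact: (lipM (y, y')).
  have [L [L0 lipL]] :=
    filter_ex (filterI (nbhs_pinfty_gt (num_real (0 : R))) lip_near).
  by exists L.
exists rho, L; split=> // [j y xy|j y y' xy xy'].
  by have [_ VT _] := lipV j; exact/VT/ball_V.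
by apply: lipL; exact: ball_V.
Qed.

(** Near [x] the minimum is attained by functions active at [x], so the
    supergradient inequality for the minimum is exactly what the limiting
    minimum rule for the active family requires. *)
Lemma superdiff_ubar_hull x p : Sigma T u x ->
  (forall j, lipschitz_near (~` T j) (u j) x) -> superdiff (ubar u) x p ->
  exists lam q, [/\ convex_weights u x lam, limiting_selection T u x q
    & \sum_(j in active u x) lam j *: q j = p].
Proof.
move=> [xT _] /common_lipschitz_ball[rho [L [rho0 L0 rhoT lip]]] /superdiffP up.
have ucx j : {for x, continuous (u j)} by exact: family_continuous.
have [|j y y' _|j|e e0|lam [q [lam0 lam1 qlim qp]]] :=
  @limiting_min_rule _ _ _ (active u x) (fun j => ~` T j) u x p (ubar u x)
    rho L rho0 L0.
- by move=> j y _; exact: rhoT.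
- exact: lip.
- by move/activeP.
- apply: filterS2 (up e e0) (near_active ucx) => y uy ymin.
  by have [j yj] := ubar_attained u y; exists j; [exact: ymin | rewrite -yj].
by exists lam, q.
Qed.

Lemma superdiff_ubar_active1 x p j : (~` union_sing T) x ->
  active u x = [set j]%SET -> superdiff (ubar u) x p -> superdiff (u j) x p.
Proof.
move=> xT act1; apply: superdiff_touch_below.
  by apply/activeP; rewrite act1 inE.
have ucx i : {for x, continuous (u i)} by exact: family_continuous.
apply: filterS (near_active ucx) => y ymin.
have [i yi] := ubar_attained u y.
by have := ymin i (esym yi); rewrite act1 inE => /eqP <-; rewrite -yi.
Qed.

Lemma ubar_supersolution :
  (forall j, viscosity_supersolution F (~` T j) (u j)) ->
  viscosity_supersolution F (~` union_sing T) (ubar u).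
Proof.
move=> usup; split=> [|x p xT /subdiffE up]; first exact: ubar_continuous_off_sing.
have [j xj] := ubar_attained u x.
rewrite xj; apply: (usup j).2; first exact: (off_singE x).1.
apply/subdiffE; apply: superdiff_touch_below up; first by rewrite xj.
by apply: (@nearW _ (nbhs x)) => y; rewrite lerN2 ubar_le.
Qed.

Lemma ubar_subsolution :
  (forall j, viscosity_subsolution F (~` T j) (u j)) ->
  (forall x j, Sigma T u x -> lipschitz_near (~` T j) (u j) x) ->
  condE F T u -> viscosity_subsolution F (~` union_sing T) (ubar u).
Proof.
move=> usub lip E; split=> [|x p xT up]; first exact: ubar_continuous_off_sing.
have [xS|xS] := ltnP 1 #|active u x|.
  have Sx : Sigma T u x by [].
  have [lam [q [wt sel <-]]] :=
    superdiff_ubar_hull Sx (fun j => lip x j Sx) up.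
  exact: E.
have /cards1P[j act1] : #|active u x| == 1%N.
  rewrite eqn_leq xS card_gt0; apply/set0Pn.
  by have [j xj] := ubar_attained u x; exists j; apply/activeP.
have <- : u j x = ubar u x by apply/activeP; rewrite act1 inE.
apply: (usub j).2; first exact: (off_singE x).1.
exact: superdiff_ubar_active1 up.
Qed.

(** The minimum lies below the average of the active functions with weights
    [lam], touches it at [x], and that average has the given gradient. *)
Lemma superdiff_ubar_convex x lam : (forall j, differentiable (u j) x) ->
  convex_weights u x lam ->
  superdiff (ubar u) x (\sum_(j in active u x) lam j *: grad (u j) x).
Proof.
move=> du [lam0 lam1]; apply/superdiffP => e e0.
have near_exp : \forall y \near x, forall j,
    `|u j y - u j x - dotp (grad (u j) x) (y - x)| <= e * `|y - x|.
  apply: (@filter_forall _ _ (fun j y =>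
    `|u j y - u j x - dotp (grad (u j) x) (y - x)| <= e * `|y - x|)
    (nbhs x) (nbhs_filter x)) => j.
  exact: differentiable_expansion.
apply: filterS near_exp => y uy.
have -> : ubar u y - ubar u x -
    dotp (\sum_(j in active u x) lam j *: grad (u j) x) (y - x) =
    \sum_(j in active u x)
      lam j * (ubar u y - ubar u x - dotp (grad (u j) x) (y - x)).
  under [RHS]eq_bigr do rewrite mulrBr.
  rewrite sumrB -mulr_suml lam1 mul1r dotp_suml; congr (_ - _).
  by apply: eq_bigr => j _; rewrite dotpZl.
rewrite -[leRHS]mul1r -lam1 mulr_suml; apply: ler_sum => j jA.
rewrite ler_wpM2l ?lam0//; have := le_trans (ler_norm _) (uy j).
by have /activeP -> := jA; have := ubar_le u j y; lra.
Qed.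

Lemma condE_of_C1 : (forall x j, Sigma T u x -> C1_near (~` T j) (u j) x) ->
  viscosity_subsolution F (~` union_sing T) (ubar u) -> condE F T u.
Proof.
move=> C1 [_ usub] x p lam Sx sel wt; have [xT _] := Sx.
have du j : differentiable (u j) x.
  by have [V [[_ Vx] _ dV _]] := C1 x j Sx; exact: dV.
have pE j : j \in active u x -> p j = grad (u j) x.
  move=> /sel [p_ [x_ [pp xx h]]]; have [V [[Vo Vx] _ dV gc]] := C1 x j Sx.
  have gcx : {for x, continuous (grad (u j))}.
    by move: gc; rewrite continuous_open_subspace//; apply; rewrite inE.
  have glim : grad (u j) (x_ i) @[i --> \oo] --> grad (u j) x.
    exact: cvg_comp xx gcx.
  have pg : \forall i \near \oo, p_ i = grad (u j) (x_ i).
    have xV : \forall i \near \oo, V (x_ i) by apply: xx; exact: open_nbhs_nbhs.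
    apply: filterS xV => i Vi; apply: superdiff_differentiable (h i).2.
    exact: dV.
  suff plim : p_ i @[i --> \oo] --> grad (u j) x.
    exact: norm_cvg_unique pp plim.
  by apply: cvg_trans glim; apply: near_eq_cvg; apply: filterS pg => i ->.
have -> : \sum_(j in active u x) lam j *: p j =
    \sum_(j in active u x) lam j *: grad (u j) x.
  by apply: eq_bigr => j jA; rewrite pE.
exact/usub/superdiff_ubar_convex.
Qed.

Lemma condE_of_condC : continuous F ->
  (forall j, viscosity_subsolution F (~` T j) (u j)) ->
  condC F T u -> condE F T u.
Proof.
move=> Fc usub C x p lam Sx sel wt; apply: le_trans (C _ _ _ Sx sel wt) _.
apply: sumr_le0 => j jA; apply: mulr_ge0_le0; first exact: wt.1.
apply: subsolution_limiting_superdiff (usub j) _ (sel j jA) => //.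
  exact: closed_openC.
by have [xT _] := Sx; exact: (off_singE x).1.
Qed.

End ViscosityMin.

Theorem proposition2p2 (R : realType) (n m' : nat)
    (F : 'rV[R]_n * R * 'rV[R]_n -> R)
    (T : 'I_m'.+1 -> set 'rV[R]_n) (u : 'I_m'.+1 -> 'rV[R]_n -> R)
    (Tclosed : forall j, closed (T j)) :
  ((forall j, viscosity_supersolution F (~` T j) (u j)) ->
    viscosity_supersolution F (~` union_sing T) (ubar u))
  /\
  ((forall j, viscosity_subsolution F (~` T j) (u j)) ->
   continuous F ->
   (forall x j, Sigma T u x -> lipschitz_near (~` T j) (u j) x) ->
   [/\ condE F T u ->
         viscosity_subsolution F (~` union_sing T) (ubar u),
       (forall x j, Sigma T u x -> C1_near (~` T j) (u j) x) ->
         viscosity_subsolution F (~` union_sing T) (ubar u) ->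
         condE F T u
     & condC F T u -> condE F T u]).
Proof.
split=> [usup|usub Fc lip].
  by apply: ubar_supersolution => // j; case: (usup j).
have ucont j : {within ~` T j, continuous (u j)} by case: (usub j).
split.
- exact: ubar_subsolution.
- exact: condE_of_C1.
- exact: condE_of_condC.
Qed.
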